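(* Let $(M,\mathfrak{p})$ be a closed oriented projective manifold of dimension $n\geqslant3$, $g$ a Riemannian metric on $M$ and $f\in C^\infty(M)$. Under the conformal change $g\mapsto\tilde g=e^{2f}g$, the function $\mathcal{S}_g$ transforms as the scalar curvature, that is, $$\mathcal{S}_{\tilde g}=e^{-2f}\left(\mathcal{S}_g+2(n-1)\Delta_gf-(n-1)(n-2)|\mathrm{d}f|_g^2\right),$$ where $\Delta_gf=-\mathrm{div}_g\,\mathrm{grad}_gf$.
   Context: Projective structures. Two torsion-free connections on $TM$ are projectively equivalent if every geodesic of one can be reparametrised to become a geodesic of the other; a projective structure $\mathfrak{p}$ on $M$ is an equivalence class of projectively equivalent torsion-free connections, and $(M,\mathfrak{p})$ is called a projective manifold. Notation. For a section $\Phi=(\Phi^i_{jk})$ of $E=S^2(T^*M)\otimes TM$ let $[\mathrm{Con}(\Phi)]_i=\Phi^k_{ik}$, for a $1$-form $\alpha$ let $[\mathrm{Sym}(\alpha)]^i_{jk}=\delta^i_j\alpha_k+\delta^i_k\alpha_j$, and let $\Phi_0:=\Phi-\tfrac1{n+1}\mathrm{Sym}(\mathrm{Con}(\Phi))$. For a Riemannian metric $g$, ${}^g\nabla$ is its Levi-Civita connection, $|\Phi|_g^2=\Phi^i_{jk}g^{jb}g^{kc}g_{ia}\Phi^a_{bc}$ and $(\mathrm{tr}_g\Phi)^i=g^{jk}\Phi^i_{jk}$. With $\Phi_g=(\nabla-{}^g\nabla)_0$ for $\nabla\in\mathfrak{p}$ (independent of the choice of $\nabla\in\mathfrak{p}$),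 define $$\mathcal{S}_g=\frac{2(n+1)}{n+2}\left[\left(\frac n2-1\right)|\Phi_g|_g^2-\mathrm{div}_g(\mathrm{tr}_g\Phi_g)\right].$$ *)

(* Defs.v *)
From HB Require Import structures.
From mathcomp Require Import all_boot all_order all_algebra.
From mathcomp Require Import all_classical all_reals all_analysis.
From mathcomp Require Import ring.
Import Order.TTheory GRing.Theory Num.Theory.
Import numFieldNormedType.Exports.

Set Implicit Arguments.
Unset Strict Implicit.
Unset Printing Implicit Defensive.

Local Open Scope classical_set_scope.
Local Open Scope ring_scope.

(* [coord] and [param] are total functions, but they only carry information on
   [dom] and [coord @` dom], where they are mutually inverse homeomorphisms. *)
Record chart (R : realType) (n : nat) (T : topologicalType) := Chart {
  dom : set T;
  coord : T -> 'rV[R]_n;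
  param : 'rV[R]_n -> T;
  dom_open : open dom;
  codom_open : open (coord @` dom);
  coordK : forall x, dom x -> param (coord x) = x;
  coord_continuous : forall x, dom x -> {for x, continuous coord};
  param_continuous : forall y, (coord @` dom) y -> {for y, continuous param} }.

(* The operator d/dx^i of the chart c, acting on real functions defined near
   the point at which the result is taken. *)
Definition partial (R : realType) (n : nat) (T : topologicalType)
    (c : chart R n T) (i : 'I_n) (h : T -> R) : T -> R :=
  fun x => 'D_(delta_mx 0 i : 'rV[R]_n) (h \o param c) (coord c x).

(* V is meant to be an open subset of dom c. *)
Fixpoint Ck_on (R : realType) (n : nat) (T : topologicalType)
    (c : chart R n T) (V : set T) (k : nat) (h : T -> R) : Prop :=
  (forall x, V x -> {for x, continuous h}) /\
  if k is k'.+1 then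
    forall i : 'I_n,
      (forall x, V x ->
         derivable (h \o param c) (coord c x) (delta_mx 0 i : 'rV[R]_n)) /\
      Ck_on c V k' (partial c i h)
  else True.

Definition smooth_on (R : realType) (n : nat) (T : topologicalType)
    (c : chart R n T) (V : set T) (h : T -> R) : Prop :=
  forall k, Ck_on c V k h.

(* All charts take values in open subsets of R^n: there is no boundary. *)
Record smooth_manifold (R : realType) (n : nat) := SmoothManifold {
  carrier :> topologicalType;
  atlas : Type;
  chart_of : atlas -> chart R n carrier;
  manifold_hausdorff : hausdorff_space carrier;
  manifold_second_countable : @second_countable carrier;
  atlas_cover : forall x : carrier, exists c, dom (chart_of c) x;
  atlas_smooth : forall (c d : atlas) (a : 'I_n),
    smooth_on (chart_of c) (dom (chart_of c) `&` dom (chart_of d))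
      (fun x => coord (chart_of d) x 0 a) }.

Coercion chart_of : atlas >-> chart.

Definition jacobian (R : realType) (n : nat) (M : smooth_manifold R n)
    (c d : atlas M) (x : M) : 'M[R]_n :=
  \matrix_(a, i) partial c i (fun y => coord d y 0 a) x.

Definition closed_manifold (R : realType) (n : nat) (M : smooth_manifold R n) :=
  compact [set: M].

Definition oriented (R : realType) (n : nat) (M : smooth_manifold R n) :=
  forall (c d : atlas M) (x : M),
    dom c x -> dom d x -> 0 < \det (jacobian c d x).

Definition smooth_function (R : realType) (n : nat) (M : smooth_manifold R n)
    (f : M -> R) :=
  forall c : atlas M, smooth_on c (dom c) f.

(* Tensor fields and connections are given by their components in every chart:
   [g c x i j] is g_ij at x and [D c x i j k] is Gamma^i_jk at x, in the chart
   c. Only the values at points of [dom c] are meaningful. *)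
Record riemannian_metric (R : realType) (n : nat) (M : smooth_manifold R n) :=
  RiemannianMetric {
  metric_comp :> atlas M -> M -> 'M[R]_n;
  metric_smooth : forall (c : atlas M) i j,
    smooth_on c (dom c) (fun x => metric_comp c x i j);
  metric_sym : forall (c : atlas M) x i j, dom c x ->
    metric_comp c x i j = metric_comp c x j i;
  metric_posdef : forall (c : atlas M) x, dom c x ->
    forall v : 'rV[R]_n, v != 0 -> 0 < (v *m metric_comp c x *m v^T) 0 0;
  metric_tensor : forall (c d : atlas M) x, dom c x -> dom d x ->
    metric_comp c x =
      (jacobian c d x)^T *m metric_comp d x *m jacobian c d x }.

Record connection (R : realType) (n : nat) (M : smooth_manifold R n) :=
  Connection {
  christoffel :> atlas M -> M -> 'I_n -> 'I_n -> 'I_n -> R;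
  christoffel_smooth : forall (c : atlas M) i j k,
    smooth_on c (dom c) (fun x => christoffel c x i j k);
  (* With x the coordinates of c, y those of d, and Gamma, Gamma' the symbols
     in c and d: Gamma^i_jk d_i y^a = d_j d_k y^a + Gamma'^a_pq d_j y^p d_k y^q,
     all derivatives being taken with respect to x. *)
  christoffel_change : forall (c d : atlas M) x, dom c x -> dom d x ->
    forall a j k : 'I_n,
    \sum_i jacobian c d x a i * christoffel c x i j k =
      partial c j (partial c k (fun y => coord d y 0 a)) x +
      \sum_p \sum_q christoffel d x a p q *
                     jacobian c d x p j * jacobian c d x q k }.

Definition torsion_free (R : realType) (n : nat) (M : smooth_manifold R n)
    (D : connection M) :=
  forall (c : atlas M) x i j k, dom c x -> D c x i j k = D c x i k j.

Definition open_interval (R : realType) (I : set R) :=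
  [/\ open I, is_interval I & I !=set0].

Definition geodesic (R : realType) (n : nat) (M : smooth_manifold R n)
    (D : connection M) (I : set R) (gamma : R -> M) : Prop :=
  (forall t, I t -> {for t, continuous gamma}) /\
  forall (c : atlas M) t, I t -> dom c (gamma t) ->
    let x i := fun s : R => coord c (gamma s) 0 i in
    (forall i, derivable (x i) t 1 /\ derivable (derive1 (x i)) t 1) /\
    forall i, derive1n 2 (x i) t +
      \sum_j \sum_k D c (gamma t) i j k * derive1 (x j) t * derive1 (x k) t = 0.

(* tau is a diffeomorphism of the open interval J onto the open interval I. *)
Definition reparametrises_to_geodesic (R : realType) (n : nat)
    (M : smooth_manifold R n) (D : connection M) (I : set R) (gamma : R -> M) :=
  exists (J : set R) (tau : R -> R),
    [/\ open_interval J,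
        forall k t, J t -> derivable (derive1n k tau) t 1,
        forall t, J t -> derive1 tau t != 0,
        tau @` J = I &
        geodesic D J (gamma \o tau)].

Definition projectively_equivalent (R : realType) (n : nat)
    (M : smooth_manifold R n) (D D' : connection M) :=
  forall (I : set R) (gamma : R -> M), open_interval I ->
    (geodesic D I gamma -> reparametrises_to_geodesic D' I gamma) /\
    (geodesic D' I gamma -> reparametrises_to_geodesic D I gamma).

Record projective_structure (R : realType) (n : nat)
    (M : smooth_manifold R n) := ProjectiveStructure {
  projective_class : set (connection M);
  projective_classP : exists2 D, torsion_free D &
    projective_class =
      [set D' | torsion_free D' /\ projectively_equivalent D D'] }.

(* Phi i j k stands for Phi^i_jk. *)
Definition Con (R : realType) (n : nat) (Phi : 'I_n -> 'I_n -> 'I_n -> R)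
    (i : 'I_n) : R :=
  \sum_k Phi k i k.

Definition Sym (R : realType) (n : nat) (alpha : 'I_n -> R)
    (i j k : 'I_n) : R :=
  (i == j)%:R * alpha k + (i == k)%:R * alpha j.

Definition trace_free_part (R : realType) (n : nat)
    (Phi : 'I_n -> 'I_n -> 'I_n -> R) (i j k : 'I_n) : R :=
  Phi i j k - n.+1%:R^-1 * Sym (Con Phi) i j k.

Definition levi_civita (R : realType) (n : nat) (M : smooth_manifold R n)
    (g : atlas M -> M -> 'M[R]_n) :
    atlas M -> M -> 'I_n -> 'I_n -> 'I_n -> R :=
  fun c x i j k => 2^-1 * \sum_l invmx (g c x) i l *
    (partial c j (fun y => g c y k l) x +
     partial c k (fun y => g c y j l) x -
     partial c l (fun y => g c y j k) x).

Definition norm2 (R : realType) (n : nat) (G : 'M[R]_n)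
    (Phi : 'I_n -> 'I_n -> 'I_n -> R) : R :=
  \sum_i \sum_j \sum_k \sum_a \sum_b \sum_c
    Phi i j k * invmx G j b * invmx G k c * G i a * Phi a b c.

Definition trace_metric (R : realType) (n : nat) (G : 'M[R]_n)
    (Phi : 'I_n -> 'I_n -> 'I_n -> R) (i : 'I_n) : R :=
  \sum_j \sum_k invmx G j k * Phi i j k.

(* Divergence in the chart c:
   the trace of the covariant derivative of X with respect to the Levi-Civita
   connection; [X y i] is the i-th component at y in the chart c. *)
Definition divergence (R : realType) (n : nat) (M : smooth_manifold R n)
    (g : atlas M -> M -> 'M[R]_n) (c : atlas M)
    (X : M -> 'I_n -> R) (x : M) : R :=
  \sum_i (partial c i (fun y => X y i) x +
          \sum_j levi_civita g c x i i j * X x j).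

Definition gradient (R : realType) (n : nat) (M : smooth_manifold R n)
    (g : atlas M -> M -> 'M[R]_n) (c : atlas M)
    (f : M -> R) (x : M) (i : 'I_n) : R :=
  \sum_j invmx (g c x) i j * partial c j f x.

Definition laplacian (R : realType) (n : nat) (M : smooth_manifold R n)
    (g : atlas M -> M -> 'M[R]_n) (c : atlas M) (f : M -> R) (x : M) : R :=
  - divergence g c (gradient g c f) x.

Definition norm2_d (R : realType) (n : nat) (M : smooth_manifold R n)
    (g : atlas M -> M -> 'M[R]_n) (c : atlas M) (f : M -> R) (x : M) : R :=
  \sum_i \sum_j invmx (g c x) i j * partial c i f x * partial c j f x.

Definition Phi_of (R : realType) (n : nat) (M : smooth_manifold R n)
    (D : connection M) (g : atlas M -> M -> 'M[R]_n) :
    atlas M -> M -> 'I_n -> 'I_n -> 'I_n -> R :=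
  fun c x => trace_free_part
    (fun i j k => D c x i j k - levi_civita g c x i j k).

(* The class of D determines [S_of]: adding Sym alpha to D does not change
   [Phi_of]. *)
Definition S_of (R : realType) (n : nat) (M : smooth_manifold R n)
    (D : connection M) (g : atlas M -> M -> 'M[R]_n) (c : atlas M)
    (x : M) : R :=
  2 * n.+1%:R / n.+2%:R *
    ((n%:R / 2 - 1) * norm2 (g c x) (Phi_of D g c x) -
     divergence g c (fun y => trace_metric (g c y) (Phi_of D g c y)) x).

Definition conformal (R : realType) (n : nat) (M : smooth_manifold R n)
    (f : M -> R) (g : atlas M -> M -> 'M[R]_n) :
    atlas M -> M -> 'M[R]_n :=
  fun c x => expR (2 * f x) *: g c x.

Lemma eq_partial (R : realType) (n : nat) (T : topologicalType)
    (c : chart R n T) (i : 'I_n) (h1 h2 : T -> R) (x : T) :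
  (forall y, dom c y -> h1 y = h2 y) -> dom c x ->
  partial c i h1 x = partial c i h2 x.
Proof.
move=> eqh cx; apply: near_eq_derive.
have : nbhs (coord c x) (coord c @` dom c).
  by apply: open_nbhs_nbhs; split; [exact: codom_open | exists x].
by apply: filterS => _ [y cy <-] /=; rewrite coordK ?eqh.
Qed.

Lemma metric_unit (R : realType) (n : nat) (M : smooth_manifold R n)
    (g : riemannian_metric M) (c : atlas M) (x : M) :
  dom c x -> g c x \in unitmx.
Proof.
move=> cx; rewrite -row_free_unit -kermx_eq0; apply/rowV0P => v /sub_kermxP vg0.
apply/eqP/negP => /negP v0; have := metric_posdef g cx v0.
by rewrite vg0 mul0mx mxE ltxx.
Qed.

(* [levi_civita] is characterised, in every chart, by being torsion-free and
   compatible with the metric. *)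
Lemma levi_civitaP (R : realType) (n : nat) (M : smooth_manifold R n)
    (g : riemannian_metric M) (c : atlas M) (x : M)
    (Gam : 'I_n -> 'I_n -> 'I_n -> R) : dom c x ->
  (forall i j k, Gam i j k = Gam i k j) /\
  (forall i j k, partial c k (fun y => g c y i j) x =
     \sum_l (Gam l k i * g c x l j + Gam l k j * g c x i l)) <->
  (forall i j k, Gam i j k = levi_civita g c x i j k).
Proof.
move=> cx; have gU := metric_unit g cx.
have dgC i j k : partial c k (fun y => g c y i j) x =
                 partial c k (fun y => g c y j i) x.
  by apply: eq_partial => // y cy; exact: metric_sym.
pose A j k l := 2^-1 * (partial c j (fun y => g c y k l) x +
     partial c k (fun y => g c y j l) x - partial c l (fun y => g c y j k) x).
have lcA i j k : levi_civita g c x i j k = \sum_l invmx (g c x) i l * A j k l.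
  rewrite /levi_civita mulr_sumr; apply: eq_bigr => l _.
  by rewrite /A mulrCA.
have AC j k l : A j k l = A k j l by rewrite /A (dgC j k l); ring.
have low j k m : \sum_l levi_civita g c x l j k * g c x l m = A j k m.
  under eq_bigr do rewrite lcA mulr_suml.
  rewrite exchange_big /=.
  have -> : A j k m = \sum_l A j k l * (invmx (g c x) *m g c x) l m.
    rewrite mulVmx // (bigD1 m) //= mxE eqxx mulr1 big1 ?addr0 // => l lm.
    by rewrite mxE (negbTE lm) mulr0.
  apply: eq_bigr => l _; rewrite mxE mulr_sumr; apply: eq_bigr => p _.
  have -> : invmx (g c x) p l = invmx (g c x) l p.
    have gT : (g c x)^T = g c x.
      by apply/matrixP => a b; rewrite mxE metric_sym.
    by rewrite -{1}gT -trmx_inv mxE.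
  by rewrite [RHS]mulrA [A j k l * _]mulrC.
split=> [[GC Gg] i j k|G].
  have lowG j' k' m : \sum_l Gam l j' k' * g c x l m = A j' k' m.
    pose B a b d := \sum_l Gam l a b * g c x l d.
    have BC a b d : B a b d = B b a d.
      by apply: eq_bigr => l _; rewrite GC.
    have dB a b d : partial c d (fun y => g c y a b) x = B d a b + B d b a.
      rewrite Gg big_split /=; congr (_ + _).
      by apply: eq_bigr => l _; rewrite (metric_sym g _ _ cx).
    rewrite -/(B _ _ _) /A !dB (BC k' j' m) (BC m j' k') (BC m k' j').
    by field.
  have sysI (u v : 'I_n -> R) :
      (forall m, \sum_l u l * g c x l m = \sum_l v l * g c x l m) -> u =1 v.
    move=> uv i'.
    have : (\row_l u l) *m g c x = (\row_l v l) *m g c x.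
      apply/rowP => m; rewrite !mxE.
      under eq_bigr do rewrite mxE.
      by under [RHS]eq_bigr do rewrite mxE.
    move=> /(congr1 (mulmxr (invmx (g c x)))) /=; rewrite !mulmxK //.
    by move=> /rowP /(_ i'); rewrite !mxE.
  apply: (sysI (fun l => Gam l j k) (fun l => levi_civita g c x l j k)) => m.
  by rewrite lowG low.
split=> i j k.
  by rewrite !G !lcA; apply: eq_bigr => l _; rewrite AC.
rewrite big_split /=.
under eq_bigr do rewrite G.
under [X in _ + X]eq_bigr do rewrite G (metric_sym g _ _ cx).
by rewrite !low /A (dgC j i k); field.
Qed.

(* Main.v *)
Require Import Defs.
From mathcomp Require Import all_boot all_order all_algebra.
From mathcomp Require Import all_classical all_reals all_analysis.
From mathcomp Require Import ring.
Import Order.TTheory GRing.Theory Num.Theory.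
Import numFieldNormedType.Exports.

Set Implicit Arguments.
Unset Strict Implicit.
Unset Printing Implicit Defensive.

Local Open Scope ring_scope.

(** Everything happens in the one chart c.  Write f_i for the derivatives of f
    and grad for the g-gradient of f.  The Christoffel symbols of exp(2f) g are
    those of g plus Sym(df)^i_jk - g_jk grad^i ([levi_civita_conformal]).  The
    operator Phi |-> Phi_0 kills Sym(df), so Phi_g changes by the trace-free
    tensor
      B^i_jk = g_jk grad^i - Sym(df)^i_jk / (n + 1)
    ([Phi_of_conformal], where B is [conformal_shift]).

    Three facts about B carry the computation.  For every symmetric trace-free
    Phi, the g-inner product of Phi with B is df(tr_g Phi): after lowering and
    raising indices, the Sym part of B only meets the contraction of Phi, which
    vanishes ([tensor_dot_conformal_shift]).  Second, tr_g B = kappa grad with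
    kappa = n - 2/(n + 1) = (n + 2)(n - 1)/(n + 1).  Third, applying the first
    fact to B itself, |B|^2 = kappa |df|^2.  Hence, with tau = tr_g Phi_g,
      |Phi|^2 becomes exp(-2f) (|Phi|^2 + 2 df(tau) + kappa |df|^2),
      tau becomes exp(-2f) (tau + kappa grad).
    Contracting the formula for the Christoffel symbols shows that the
    divergence of exp(-2f) X for the new metric is
    exp(-2f) (div X + (n - 2) df(X)) ([divergence_conformal]).

    In S the terms in df(tau) then cancel, because
    (n/2 - 1) 2 df(tau) = (n - 2) df(tau): the coefficient of the norm in the
    definition of S is the one that makes this happen.  What remains is kappa
    times the Laplacian of f and -(n - 2)/2 kappa |df|^2, and the factor
    2(n + 1)/(n + 2) turns kappa into 2(n - 1).

    Analysis enters through the product rule, used for exp(2f) g and for the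
    divergence of tau + kappa grad: the functions involved have to be
    differentiable, which is obtained by following their explicit expressions
    in g, D and f. *)

(** * Sums over indices *)

Lemma sum_delta (R : realType) (n : nat) (i : 'I_n) (F : 'I_n -> R) :
  \sum_k (i == k)%:R * F k = F i.
Proof.
rewrite (bigD1 i) //= eqxx mul1r big1 ?addr0 // => k /negbTE ki.
by rewrite eq_sym ki mul0r.
Qed.

Lemma exchange_sum3 (R : realType) (n : nat)
    (F : 'I_n -> 'I_n -> 'I_n -> 'I_n -> 'I_n -> 'I_n -> R) :
  \sum_i \sum_j \sum_k \sum_a \sum_b \sum_c F i j k a b c =
  \sum_a \sum_b \sum_c \sum_i \sum_j \sum_k F i j k a b c.
Proof.
have sum3 (H : 'I_n -> 'I_n -> 'I_n -> R) :
    \sum_i \sum_j \sum_k H i j k =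
    \sum_(t : 'I_n * 'I_n * 'I_n) H t.1.1 t.1.2 t.2.
  by rewrite pair_big pair_big.
rewrite !sum3; under eq_bigr do rewrite sum3.
by rewrite exchange_big; apply: eq_bigr => t _; rewrite sum3.
Qed.

(** * Trace-free tensors over a nondegenerate symmetric form *)

Section PointwiseAlgebra.
Context (R : realType) (n : nat) (G : 'M[R]_n).
Hypothesis G_unit : G \in unitmx.
Hypothesis G_sym : G^T = G.

Notation Gi := (invmx G).
Notation tensor12 := ('I_n -> 'I_n -> 'I_n -> R).

Definition sharp (u : 'I_n -> R) (i : 'I_n) : R := \sum_j Gi i j * u j.

(** The bilinear form whose quadratic form is [norm2]. *)
Definition tensor_dot (Phi Psi : tensor12) : R :=
  \sum_i \sum_j \sum_k \sum_a \sum_b \sum_c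
    Phi i j k * Gi j b * Gi k c * G i a * Psi a b c.

(** The trace-free part of [G j k * sharp u i]; for u = df this is the change of
    the trace-free difference tensor under a conformal change of metric. *)
Definition conformal_shift (u : 'I_n -> R) : tensor12 :=
  fun i j k => G j k * sharp u i - n.+1%:R^-1 * Sym u i j k.

Let entryC i j : G i j = G j i. Proof. by rewrite -{1}G_sym mxE. Qed.

Lemma invmx_entryC i j : Gi i j = Gi j i.
Proof. by rewrite -{1}G_sym -trmx_inv mxE. Qed.

Lemma sum_metric_invmx i j : \sum_a G i a * Gi j a = (i == j)%:R.
Proof.
have <- : (G *m Gi) i j = (i == j)%:R by rewrite mulmxV // mxE.
by rewrite mxE; apply: eq_bigr => a _; rewrite [Gi j a]invmx_entryC.
Qed.

Lemma sum_metric_sharp u i : \sum_a G i a * sharp u a = u i.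
Proof.
under eq_bigr do rewrite mulr_sumr.
rewrite exchange_big /= -[RHS](sum_delta i u).
apply: eq_bigr => j _; rewrite -sum_metric_invmx mulr_suml.
by apply: eq_bigr => a _; rewrite mulrA [Gi j a]invmx_entryC.
Qed.

Lemma tensor_dotC Phi Psi : tensor_dot Phi Psi = tensor_dot Psi Phi.
Proof.
rewrite /tensor_dot exchange_sum3; do 6!apply: eq_bigr => ? _.
rewrite [Gi _ _]invmx_entryC [X in _ * X * _ * _]invmx_entryC [G _ _]entryC.
ring.
Qed.

Lemma norm2D Phi Psi :
  norm2 G (fun i j k => Phi i j k + Psi i j k) =
  norm2 G Phi + 2 * tensor_dot Phi Psi + norm2 G Psi.
Proof.
rewrite mulr_natl mulr2n {2}tensor_dotC /norm2 /tensor_dot.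
do 6!(rewrite -?big_split /=; apply: eq_bigr => ? _); ring.
Qed.

(** Moving all three indices exchanges the roles of G and its inverse and of u
    and its dual vector.  The sums over c, b and a are carried out in this
    order, each one being a contraction of G with its inverse. *)
Lemma move_indices_conformal_shift u i j k :
  \sum_a \sum_b \sum_c
    Gi j b * Gi k c * G i a * conformal_shift u a b c =
  Gi j k * u i - n.+1%:R^-1 * Sym (sharp u) i j k.
Proof.
set t := n.+1%:R^-1.
have contract_c a b : \sum_c Gi k c * conformal_shift u a b c =
    (k == b)%:R * sharp u a - t * ((a == b)%:R * sharp u k + Gi k a * u b).
  transitivity ((\sum_c G b c * Gi k c) * sharp u a -
     t * ((a == b)%:R * (\sum_c Gi k c * u c) +
          (\sum_c (a == c)%:R * Gi k c) * u b)).
    rewrite !(mulr_suml, mulr_sumr) -big_split /= mulr_sumr -sumrB.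
    by apply: eq_bigr => c _; rewrite /conformal_shift /Sym -/t; ring.
  by rewrite sum_metric_invmx sum_delta eq_sym.
have contract_b a : \sum_b \sum_c
      Gi j b * Gi k c * G i a * conformal_shift u a b c =
    G i a * (Gi j k * sharp u a -
             t * (Gi j a * sharp u k + Gi k a * sharp u j)).
  transitivity (G i a * ((\sum_b (k == b)%:R * Gi j b) * sharp u a -
     t * ((\sum_b (a == b)%:R * Gi j b) * sharp u k +
          Gi k a * (\sum_b Gi j b * u b)))); last by rewrite !sum_delta.
  rewrite !(mulr_suml, mulr_sumr) -big_split /= mulr_sumr -sumrB mulr_sumr.
  apply: eq_bigr => b _.
  transitivity (G i a * Gi j b * (\sum_c Gi k c * conformal_shift u a b c)).
    by rewrite mulr_sumr; apply: eq_bigr => c _; ring.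
  by rewrite contract_c; ring.
transitivity (Gi j k * (\sum_a G i a * sharp u a) -
     t * ((\sum_a G i a * Gi j a) * sharp u k +
          (\sum_a G i a * Gi k a) * sharp u j)); last first.
  by rewrite sum_metric_sharp !sum_metric_invmx.
rewrite !(mulr_suml, mulr_sumr) -big_split /= mulr_sumr -sumrB.
by apply: eq_bigr => a _; rewrite contract_b; ring.
Qed.

(** Against [Gi j k * u i] the tensor Phi gives its metric trace; against the
    Sym part it gives [Con Phi], once for each of the two lower indices by
    symmetry, and this is zero. *)
Lemma tensor_dot_conformal_shift Phi u :
  (forall i j k, Phi i j k = Phi i k j) -> (forall i, Con Phi i = 0) ->
  tensor_dot Phi (conformal_shift u) = \sum_i u i * trace_metric G Phi i.
Proof.
move=> PhiC ConPhi.
transitivity (\sum_i \sum_j \sum_k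
    Phi i j k * (Gi j k * u i - n.+1%:R^-1 * Sym (sharp u) i j k)).
  do 3!apply: eq_bigr => ? _; rewrite -move_indices_conformal_shift !mulr_sumr.
  apply: eq_bigr => ? _; rewrite !mulr_sumr.
  by apply: eq_bigr => ? _; rewrite !mulr_sumr; apply: eq_bigr => ? _; ring.
transitivity (\sum_i (u i * trace_metric G Phi i) -
  n.+1%:R^-1 * (\sum_k Con Phi k * sharp u k + \sum_j Con Phi j * sharp u j)).
  have sum_ij : \sum_k Con Phi k * sharp u k =
      \sum_i \sum_j \sum_k (i == j)%:R * (Phi i j k * sharp u k).
    under [RHS]eq_bigr do rewrite exchange_big /=.
    rewrite [RHS]exchange_big; apply: eq_bigr => k _ /=.
    rewrite mulr_suml; apply: eq_bigr => i _.
    by rewrite (sum_delta i (fun j => Phi i j k * sharp u k)) PhiC.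
  have sum_ik : \sum_k Con Phi k * sharp u k =
      \sum_i \sum_j \sum_k (i == k)%:R * (Phi i j k * sharp u j).
    rewrite [RHS]exchange_big; apply: eq_bigr => j _ /=.
    rewrite mulr_suml; apply: eq_bigr => i _.
    by rewrite (sum_delta i (fun k => Phi i j k * sharp u j)).
  rewrite {1}sum_ij sum_ik -big_split /= mulr_sumr -sumrB.
  apply: eq_bigr => i _; rewrite -big_split /= !mulr_sumr -sumrB.
  apply: eq_bigr => j _.
  rewrite -big_split /= !mulr_sumr -sumrB; apply: eq_bigr => k _.
  by rewrite /Sym; ring.
rewrite (_ : \sum_k Con Phi k * sharp u k = 0) ?addr0 ?mulr0 ?subr0 //.
by apply: big1 => k _; rewrite ConPhi mul0r.
Qed.

(** This explains the factor 1/(n + 1) in [trace_free_part]. *)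
Lemma Con_Sym (u : 'I_n -> R) i : Con (Sym u) i = n.+1%:R * u i.
Proof.
rewrite /Con /Sym big_split /= [X in X + _](_ : _ = u i); last first.
  by under eq_bigr do rewrite eq_sym; exact: sum_delta.
under eq_bigr do rewrite eqxx mul1r.
by rewrite sumr_const card_ord -mulr_natl -addn1 natrD; ring.
Qed.

Lemma conformal_shiftC u i j k :
  conformal_shift u i j k = conformal_shift u i k j.
Proof. by rewrite /conformal_shift /Sym [G j k]entryC; ring. Qed.

Lemma Con_conformal_shift u i : Con (conformal_shift u) i = 0.
Proof.
have E : \sum_k G i k * sharp u k - n.+1%:R^-1 * Con (Sym u) i = 0.
  by rewrite sum_metric_sharp Con_Sym mulKf ?subrr // pnatr_eq0.
by rewrite -[RHS]E /Con mulr_sumr -sumrB.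
Qed.

Lemma trace_conformal_shift u i :
  trace_metric G (conformal_shift u) i =
  (n%:R - 2 / n.+1%:R) * sharp u i.
Proof.
transitivity ((\sum_(j < n) \sum_k G j k * Gi j k) * sharp u i -
   n.+1%:R^-1 * (\sum_j (i == j)%:R * (\sum_k Gi j k * u k) +
                 \sum_k (i == k)%:R * (\sum_j Gi k j * u j))).
  have swap : \sum_k (i == k)%:R * (\sum_j Gi k j * u j) =
      \sum_j \sum_k (i == k)%:R * (Gi j k * u j).
    rewrite [RHS]exchange_big; apply: eq_bigr => k _; rewrite mulr_sumr.
    by apply: eq_bigr => j _; rewrite [Gi k j]invmx_entryC.
  rewrite {2}swap -big_split /= mulr_suml mulr_sumr -sumrB.
  apply: eq_bigr => j _.
  rewrite mulr_suml [(i == j)%:R * _]mulr_sumr -big_split /= mulr_sumr -sumrB.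
  by apply: eq_bigr => k _; rewrite /conformal_shift /Sym; ring.
rewrite !sum_delta -/(sharp u i).
under eq_bigr do rewrite sum_metric_invmx eqxx.
rewrite sumr_const card_ord -[true%:R *+ n]/(n%:R : R).
ring.
Qed.

(** The shift is itself symmetric and trace-free, so
    [tensor_dot_conformal_shift] evaluates both the cross term and the square
    of the shift. *)
Lemma norm2_conformal_shift Phi u :
  (forall i j k, Phi i j k = Phi i k j) -> (forall i, Con Phi i = 0) ->
  norm2 G (fun i j k => Phi i j k + conformal_shift u i j k) =
  norm2 G Phi + 2 * (\sum_i u i * trace_metric G Phi i) +
  (n%:R - 2 / n.+1%:R) * \sum_i u i * sharp u i.
Proof.
move=> PhiC ConPhi; rewrite norm2D tensor_dot_conformal_shift //; congr (_ + _).
rewrite -[LHS]/(tensor_dot _ _) tensor_dot_conformal_shift; first last.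
- exact: Con_conformal_shift.
- exact: conformal_shiftC.
rewrite mulr_sumr; apply: eq_bigr => i _.
by rewrite trace_conformal_shift mulrCA.
Qed.

(** The two lower indices of Phi are contracted with the inverse of G and its
    upper index with G: the weights add up to -1. *)
Lemma norm2Z a Phi : a != 0 -> norm2 (a *: G) Phi = a^-1 * norm2 G Phi.
Proof.
move=> a0; rewrite /norm2 invmxZ ?unitmxZ ?unitfE //.
by do 6!(rewrite mulr_sumr; apply: eq_bigr => ? _); rewrite !mxE; field.
Qed.

Lemma trace_metricZ a Phi i :
  a != 0 -> trace_metric (a *: G) Phi i = a^-1 * trace_metric G Phi i.
Proof.
move=> a0; rewrite /trace_metric invmxZ ?unitmxZ ?unitfE //.
by do 2!(rewrite mulr_sumr; apply: eq_bigr => ? _); rewrite !mxE mulrA.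
Qed.

End PointwiseAlgebra.

Lemma Con_trace_free_part (R : realType) (n : nat)
    (Phi : 'I_n -> 'I_n -> 'I_n -> R) i : Con (trace_free_part Phi) i = 0.
Proof.
have E : Con Phi i - n.+1%:R^-1 * Con (Sym (Con Phi)) i = 0.
  by rewrite Con_Sym mulKf ?subrr // pnatr_eq0.
by rewrite -[RHS]E /Con mulr_sumr -sumrB.
Qed.

(** * Calculus of partial derivatives in a chart *)

Section PartialCalculus.
Context (R : realType) (n : nat) (T : topologicalType) (c : chart R n T).
Implicit Types (h k : T -> R) (i : 'I_n) (x : T).

Definition pderivable (i : 'I_n) (x : T) (h : T -> R) : Prop :=
  derivable (h \o param c) (Defs.coord c x) (delta_mx 0 i : 'rV[R]_n).

Lemma eq_pderivable i x h k :
  dom c x -> (forall y, dom c y -> h y = k y) ->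
  pderivable i x k -> pderivable i x h.
Proof.
move=> cx hk; apply: near_eq_derivable.
have : nbhs (Defs.coord c x) (Defs.coord c @` dom c)%classic.
  by apply: open_nbhs_nbhs; split; [exact: codom_open | exists x].
by apply: filterS => _ [y cy <-] /=; rewrite coordK ?hk.
Qed.

Lemma pderivable_cst i x (a : R) : pderivable i x (fun=> a).
Proof. exact: derivable_cst. Qed.

Lemma pderivableD i x h k : pderivable i x h -> pderivable i x k ->
  pderivable i x (fun y => h y + k y).
Proof. exact: derivableD. Qed.

Lemma pderivableM i x h k : pderivable i x h -> pderivable i x k ->
  pderivable i x (fun y => h y * k y).
Proof. exact: derivableM. Qed.

Lemma pderivableN i x h : pderivable i x h -> pderivable i x (fun y => - h y).
Proof. exact: derivableN. Qed.

Lemma pderivable_sum (I : Type) (r : seq I) (P : pred I) (F : I -> T -> R) i x :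
  (forall a, pderivable i x (F a)) ->
  pderivable i x (fun y => \sum_(a <- r | P a) F a y).
Proof.
move=> dF; elim: r => [|a r IHr].
  by under eq_fun do rewrite big_nil; exact: pderivable_cst.
under eq_fun do rewrite big_cons.
by case: (P a); [exact: pderivableD (dF a) IHr | exact: IHr].
Qed.

Lemma pderivable_prod (I : Type) (r : seq I) (P : pred I)
    (F : I -> T -> R) i x :
  (forall a, pderivable i x (F a)) ->
  pderivable i x (fun y => \prod_(a <- r | P a) F a y).
Proof.
move=> dF; elim: r => [|a r IHr].
  by under eq_fun do rewrite big_nil; exact: pderivable_cst.
under eq_fun do rewrite big_cons.
by case: (P a); [exact: pderivableM (dF a) IHr | exact: IHr].
Qed.

Lemma pderivable_det m (A : T -> 'M[R]_m) i x :
  (forall a b, pderivable i x (fun y => A y a b)) ->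
  pderivable i x (fun y => \det (A y)).
Proof.
move=> dA; apply: pderivable_sum => s; apply: pderivableM.
  exact: pderivable_cst.
by apply: pderivable_prod => a; exact: dA.
Qed.

(** Cramer's rule: near x the entries are cofactors divided by a nonvanishing
    determinant. *)
Lemma pderivable_invmx m (A : T -> 'M[R]_m) i x a b :
  dom c x -> (forall y, dom c y -> A y \in unitmx) ->
  (forall a b, pderivable i x (fun y => A y a b)) ->
  pderivable i x (fun y => invmx (A y) a b).
Proof.
move=> cx AU dA.
apply: (eq_pderivable
    (k := fun y => (\det (A y))^-1 * cofactor (A y) b a)) => //.
  by move=> y cy; rewrite /invmx AU // !mxE.
apply: pderivableM.
  apply: derivableV; last exact: pderivable_det.
  by rewrite /= coordK //; have := AU _ cx; rewrite unitmxE unitfE.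
apply: pderivableM; first exact: pderivable_cst.
by apply: pderivable_det => ? ?; under eq_fun do rewrite !mxE; exact: dA.
Qed.

Lemma partialD i x h k : pderivable i x h -> pderivable i x k ->
  partial c i (fun y => h y + k y) x = partial c i h x + partial c i k x.
Proof. exact: deriveD. Qed.

Lemma partialM i x h k : dom c x -> pderivable i x h -> pderivable i x k ->
  partial c i (fun y => h y * k y) x =
  h x * partial c i k x + k x * partial c i h x.
Proof.
move=> cx dh dk; have := deriveM dh dk.
by rewrite /= coordK.
Qed.

(** The chain rule in one variable applies after restriction to the line
    t |-> coord c x + t e_i, where directional derivatives are ordinary ones. *)
Lemma derivable_expR_scale i x h (a : R) : dom c x -> pderivable i x h ->
  pderivable i x (fun y => expR (a * h y)) /\
  partial c i (fun y => expR (a * h y)) x =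
    a * expR (a * h x) * partial c i h x.
Proof.
move=> cx dh.
pose line (k : T -> R) (t : R) :=
  k (param c (t *: delta_mx 0 i + Defs.coord c x)).
have line0 k : line k 0 = k x by rewrite /line scale0r add0r coordK.
have derive_line k : partial c i k x = 'D_1 (line k) 0.
  rewrite /partial /derive; set g1 := fun t => t^-1 *: _.
  set g2 := fun t => t^-1 *: _; suff -> : g1 = g2 by [].
  rewrite /g1 /g2 /line; apply/funext => t /=.
  by rewrite addr0 scale0r add0r [t%:A]mulr1.
have dl : is_derive (0 : R) (1 : R) (line h) (partial c i h x).
  rewrite derive_line; apply: derivableP.
  exact: (derivable1P _ _ _).1 dh.
have dE : is_derive (0 : R) (1 : R) (line (fun y => expR (a * h y)))
    (expR (a * h x) * (a * partial c i h x)).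
  have dal : is_derive (0 : R) (1 : R) (fun t => a * line h t)
      (a * partial c i h x) by exact: (is_deriveZ a dl).
  have dexp : is_derive (a * line h 0) (1 : R) expR (expR (a * h x)).
    by rewrite line0; exact: is_derive_expR.
  exact: (is_derive1_comp (g := fun t => a * line h t) dexp dal).
case: dE => dE derE; split; first exact: (derivable1P _ _ _).2 dE.
rewrite derive_line derE; ring.
Qed.

End PartialCalculus.

(** * Conformal change of the metric *)

Section ConformalChange.
Context (R : realType) (n : nat) (M : smooth_manifold R n).
Context (g : riemannian_metric M) (f : M -> R) (c : atlas M).
Hypothesis f_smooth : smooth_function f.

Notation df := (fun y i => partial c i f y).

Lemma metric_trmx y : dom c y -> (g c y)^T = g c y.
Proof. by move=> cy; apply/matrixP => i j; rewrite mxE Defs.metric_sym. Qed.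

Lemma smooth_on_pderivable V (h : M -> R) i y :
  smooth_on c V h -> V y -> pderivable c i y h.
Proof. by move=> h_smooth Vy; have [_ /(_ i) [+ _]] := h_smooth 1%N; apply. Qed.

Lemma smooth_on_partial V (h : M -> R) i :
  smooth_on c V h -> smooth_on c V (partial c i h).
Proof. by move=> h_smooth k; have [_ /(_ i) []] := h_smooth k.+1. Qed.

Lemma pderivable_metric i y j k :
  dom c y -> pderivable c i y (fun z => g c z j k).
Proof. exact: smooth_on_pderivable (metric_smooth g c j k). Qed.

Lemma pderivable_invmx_metric i y j k :
  dom c y -> pderivable c i y (fun z => invmx (g c z) j k).
Proof.
move=> cy; apply: pderivable_invmx => //; first by move=> z; exact: metric_unit.
by move=> a b; exact: pderivable_metric.
Qed.

Lemma pderivable_df i y j : dom c y -> pderivable c i y (partial c j f).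
Proof.
by apply: smooth_on_pderivable; exact/smooth_on_partial/f_smooth.
Qed.

Lemma pderivable_levi_civita i y a j k :
  dom c y -> pderivable c i y (fun z => levi_civita g c z a j k).
Proof.
move=> cy; have d2g b p q : pderivable c i y (partial c b (fun z => g c z p q)).
  exact: smooth_on_pderivable (smooth_on_partial b (metric_smooth g c p q)) cy.
apply: pderivableM; first exact: pderivable_cst.
apply: pderivable_sum => l; apply: pderivableM.
  exact: pderivable_invmx_metric.
by apply: pderivableD; [exact: pderivableD | exact: pderivableN].
Qed.

Lemma pderivable_Phi_of (D : connection M) i y a j k :
  dom c y -> pderivable c i y (fun z => Phi_of D g c z a j k).
Proof.
move=> cy; pose A z a j k := D c z a j k - levi_civita g c z a j k.
have dA a' j' k' : pderivable c i y (fun z => A z a' j' k').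
  apply: pderivableD; last exact/pderivableN/pderivable_levi_civita.
  exact: smooth_on_pderivable (christoffel_smooth D c a' j' k') cy.
have dCon b : pderivable c i y (fun z => Con (A z) b).
  by apply: pderivable_sum => ?; exact: dA.
apply: pderivableD; first exact: dA.
apply/pderivableN/pderivableM; first exact: pderivable_cst.
by apply: pderivableD; apply: pderivableM => //; exact: pderivable_cst.
Qed.

Lemma pderivable_trace_Phi_of (D : connection M) i y a : dom c y ->
  pderivable c i y (fun z => trace_metric (g c z) (Phi_of D g c z) a).
Proof.
move=> cy; apply: pderivable_sum => j; apply: pderivable_sum => k.
apply: pderivableM; first exact: pderivable_invmx_metric.
exact: pderivable_Phi_of.
Qed.

Lemma pderivable_gradient i y a :
  dom c y -> pderivable c i y (fun z => gradient g c f z a).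
Proof.
move=> cy; apply: pderivable_sum => j.
by apply: pderivableM; [exact: pderivable_invmx_metric | exact: pderivable_df].
Qed.

Lemma partial_expR_scale a i y : dom c y ->
  pderivable c i y (fun z => expR (a * f z)) /\
  partial c i (fun z => expR (a * f z)) y = a * expR (a * f y) * df y i.
Proof.
by move=> cy; apply: derivable_expR_scale => //; exact: smooth_on_pderivable cy.
Qed.

Lemma expR_conformal_factorV y : (expR (2 * f y))^-1 = expR (- 2 * f y).
Proof. by rewrite -expRN mulNr. Qed.

(** Each of the three derivatives of exp(2f) g in the Christoffel symbols
    contributes twice a derivative of f times g; contracted with the inverse of
    g, the first two give the terms of Sym(df) and the last one the gradient. *)
Lemma levi_civita_conformal y i j k : dom c y ->
  levi_civita (conformal f g) c y i j k =
  levi_civita g c y i j k + Sym (df y) i j k -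
  g c y j k * gradient g c f y i.
Proof.
move=> cy; have gU := metric_unit g cy; have gT := metric_trmx cy.
have dconf a p q : partial c a (fun z => conformal f g c z p q) y =
    expR (2 * f y) *
      (2 * df y a * g c y p q + partial c a (fun z => g c z p q) y).
  under eq_fun do rewrite mxE.
  have [de E] := partial_expR_scale 2 a cy.
  by rewrite partialM // ?E; [ring | exact: pderivable_metric].
have e0 : expR (2 * f y) != 0 by rewrite gt_eqF ?expR_gt0.
transitivity (levi_civita g c y i j k +
    ((\sum_l g c y j l * invmx (g c y) i l) * df y k +
     (\sum_l g c y k l * invmx (g c y) i l) * df y j) -
    g c y j k * gradient g c f y i); last first.
  by rewrite !(sum_metric_invmx gU gT) /Sym [k == i]eq_sym [j == i]eq_sym.
rewrite /levi_civita /gradient !mulr_sumr !mulr_suml -!big_split /= -sumrB.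
apply: eq_bigr => l _; rewrite !dconf /conformal invmxZ ?unitmxZ ?unitfE // mxE.
by field.
Qed.

(** The term Sym(df) is pure trace, hence invisible to [trace_free_part]; the
    term in g_jk keeps its trace-free part. *)
Lemma Phi_of_conformal (D : connection M) y i j k : dom c y ->
  Phi_of D (conformal f g) c y i j k =
  Phi_of D g c y i j k + conformal_shift (g c y) (df y) i j k.
Proof.
move=> cy; have gU := metric_unit g cy; have gT := metric_trmx cy.
set A := fun i j k => D c y i j k - levi_civita g c y i j k.
set B := fun i j k => D c y i j k - levi_civita (conformal f g) c y i j k.
have BA a p q : B a p q =
    A a p q - Sym (df y) a p q + g c y p q * sharp (g c y) (df y) a.
  by rewrite /B /A levi_civita_conformal // /gradient /sharp; ring.
have ConB a : Con B a = Con A a - n.+1%:R * df y a + df y a.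
  transitivity (Con A a - Con (Sym (df y)) a +
      \sum_b g c y a b * sharp (g c y) (df y) b).
    by rewrite /Con -sumrB -big_split; apply: eq_bigr => b _; exact: BA.
  by rewrite Con_Sym sum_metric_sharp.
have n1 : n.+1%:R != 0 :> R by rewrite pnatr_eq0.
rewrite -[LHS]/(trace_free_part B i j k) -[Phi_of D g c y]/(trace_free_part A).
rewrite /trace_free_part /conformal_shift BA /Sym !ConB.
by field.
Qed.

Lemma Phi_ofC (D : connection M) y i j k : torsion_free D -> dom c y ->
  Phi_of D g c y i j k = Phi_of D g c y i k j.
Proof.
move=> D_tf cy.
have lcC := ((levi_civitaP g (levi_civita g c y) cy).2 (fun _ _ _ => erefl)).1.
rewrite /Phi_of /trace_free_part (D_tf _ _ _ _ _ cy) lcC /Sym.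
by rewrite [X in _ * X]addrC.
Qed.

Lemma trace_Phi_of_conformal (D : connection M) y i : dom c y ->
  trace_metric (conformal f g c y) (Phi_of D (conformal f g) c y) i =
  expR (- 2 * f y) * (trace_metric (g c y) (Phi_of D g c y) i +
                      (n%:R - 2 / n.+1%:R) * gradient g c f y i).
Proof.
move=> cy; have gU := metric_unit g cy; have gT := metric_trmx cy.
rewrite /conformal trace_metricZ ?gt_eqF ?expR_gt0 // expR_conformal_factorV.
congr (_ * _); rewrite -[gradient _ _ _ _ _]/(sharp (g c y) (df y) i).
rewrite -trace_conformal_shift // /trace_metric -big_split.
apply: eq_bigr => a _; rewrite -big_split; apply: eq_bigr => b _.
by rewrite Phi_of_conformal //= mulrDr.
Qed.

Lemma norm2_Phi_of_conformal (D : connection M) y :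
  torsion_free D -> dom c y ->
  norm2 (conformal f g c y) (Phi_of D (conformal f g) c y) =
  expR (- 2 * f y) * (norm2 (g c y) (Phi_of D g c y) +
    2 * (\sum_i df y i * trace_metric (g c y) (Phi_of D g c y) i) +
    (n%:R - 2 / n.+1%:R) * norm2_d g c f y).
Proof.
move=> D_tf cy; have gU := metric_unit g cy; have gT := metric_trmx cy.
have -> : Phi_of D (conformal f g) c y =
    fun i j k => Phi_of D g c y i j k + conformal_shift (g c y) (df y) i j k.
  by apply/funext => i; apply/funext => j; apply/funext => k;
     exact: Phi_of_conformal.
rewrite /conformal norm2Z ?gt_eqF ?expR_gt0 // expR_conformal_factorV.
rewrite (norm2_conformal_shift gU gT); first last.
- by move=> i; exact: Con_trace_free_part.
- by move=> i j k; exact: Phi_ofC.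
congr (_ * (_ + _ * _)); apply: eq_bigr => i _; rewrite mulr_sumr.
by apply: eq_bigr => j _; ring.
Qed.

Lemma eq_divergence (G : atlas M -> M -> 'M[R]_n) (X Y : M -> 'I_n -> R) x :
  dom c x -> (forall y i, dom c y -> X y i = Y y i) ->
  divergence G c X x = divergence G c Y x.
Proof.
move=> cx XY; apply: eq_bigr => i _; congr (_ + _).
  by apply: eq_partial => // y cy; exact: XY.
by apply: eq_bigr => j _; rewrite XY.
Qed.

Lemma divergenceD_scale (G : atlas M -> M -> 'M[R]_n)
    (X Y : M -> 'I_n -> R) a x :
  dom c x -> (forall i, pderivable c i x (fun y => X y i)) ->
  (forall i, pderivable c i x (fun y => Y y i)) ->
  divergence G c (fun y i => X y i + a * Y y i) x =
  divergence G c X x + a * divergence G c Y x.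
Proof.
move=> cx dX dY; rewrite /divergence mulr_sumr -big_split /=.
apply: eq_bigr => i _.
rewrite partialD //; last by apply: pderivableM => //; exact: pderivable_cst.
rewrite partialM //; last exact: pderivable_cst.
have -> : partial c i (fun=> a) x = 0 by exact: derive_cst.
rewrite mulr0 addr0 mulrDr mulr_sumr addrACA -big_split /=.
by congr (_ + _); apply: eq_bigr => j _; ring.
Qed.

(** The trace of the Christoffel symbols changes by n df, as the volume form
    scales by exp(nf); the product rule for exp(-2f) contributes -2 df. *)
Lemma divergence_conformal (X : M -> 'I_n -> R) x : dom c x ->
  (forall i, pderivable c i x (fun y => X y i)) ->
  divergence (conformal f g) c (fun y i => expR (- 2 * f y) * X y i) x =
  expR (- 2 * f x) *
    (divergence g c X x + (n%:R - 2) * \sum_i df x i * X x i).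
Proof.
move=> cx dX; have gU := metric_unit g cx; have gT := metric_trmx cx.
have lc_trace j : \sum_i levi_civita (conformal f g) c x i i j =
    \sum_i levi_civita g c x i i j + n%:R * df x j.
  under eq_bigr do rewrite levi_civita_conformal //.
  rewrite sumrB big_split /=.
  have -> : \sum_i Sym (df x) i i j = n.+1%:R * df x j.
    by rewrite -(Con_Sym (df x) j); apply: eq_bigr => i _; exact: addrC.
  have -> : \sum_i g c x i j * gradient g c f x i = df x j.
    rewrite -(sum_metric_sharp gU gT (df x)); apply: eq_bigr => i _.
    by rewrite (Defs.metric_sym g _ _ cx).
  by rewrite -addn1 natrD; ring.
have div_split (G : atlas M -> M -> 'M[R]_n) (Y : M -> 'I_n -> R) :
    divergence G c Y x = \sum_i partial c i (fun y => Y y i) x +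
      \sum_j (\sum_i levi_civita G c x i i j) * Y x j.
  rewrite /divergence big_split /=; congr (_ + _); rewrite exchange_big.
  by apply: eq_bigr => j _; rewrite mulr_suml.
rewrite !div_split -addrA mulrDr mulr_sumr mulrDr 3!mulr_sumr -!big_split /=.
apply: eq_bigr => i _; have [de E] := partial_expR_scale (- 2) i cx.
by rewrite partialM // E lc_trace; ring.
Qed.

End ConformalChange.

Theorem lemma5p1 (R : realType) (n : nat) (hn : (3 <= n)%N)
    (M : smooth_manifold R n) (M_closed : closed_manifold M)
    (M_oriented : oriented M) (p : projective_structure M)
    (g : riemannian_metric M) (f : M -> R) (f_smooth : smooth_function f)
    (D : connection M) (D_p : projective_class p D)
    (c : atlas M) (x : M) (x_c : dom c x) :
  S_of D (conformal f g) c x =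
    expR (- 2 * f x) *
      (S_of D g c x + 2 * (n%:R - 1) * laplacian g c f x -
       (n%:R - 1) * (n%:R - 2) * norm2_d g c f x).
Proof.
have D_tf : torsion_free D.
  by have [D0 _ Ecls] := projective_classP p; move: D_p; rewrite Ecls => -[].
set tau := fun y => trace_metric (g c y) (Phi_of D g c y).
set k : R := n%:R - 2 / n.+1%:R.
have dtau i : pderivable c i x (fun y => tau y i).
  exact: pderivable_trace_Phi_of.
have dgrad i : pderivable c i x (fun y => gradient g c f y i).
  exact: pderivable_gradient.
have div_conf : divergence (conformal f g) c (fun y =>
      trace_metric (conformal f g c y) (Phi_of D (conformal f g) c y)) x =
    expR (- 2 * f x) * (divergence g c tau x - k * laplacian g c f x +
      (n%:R - 2) * (\sum_i partial c i f x * tau x i + k * norm2_d g c f x)).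
  rewrite (eq_divergence _ (Y := fun y i => expR (- 2 * f y) *
             (tau y i + k * gradient g c f y i))) //; last first.
    by move=> y i cy; exact: trace_Phi_of_conformal.
  rewrite divergence_conformal //; last first.
    by move=> i; apply: pderivableD => //; apply: pderivableM => //;
       exact: pderivable_cst.
  rewrite divergenceD_scale // /laplacian mulrN opprK.
  congr (_ * (_ + _ * _)); rewrite mulr_sumr -big_split /=.
  apply: eq_bigr => i _; rewrite mulrDr; congr (_ + _).
  rewrite /gradient !mulr_sumr; apply: eq_bigr => j _; ring.
rewrite /S_of div_conf norm2_Phi_of_conformal // -/tau -/k.
by rewrite /k; field; rewrite nat1r -natrD !pnatr_eq0.
Qed.
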